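(* Let $m\ge 8$ be even and let $n$ satisfy $$\binom{m-1}{m/2-1}-\frac m2<n\le\binom{m-1}{m/2-1}.$$ Then $CAN(3,n+1,2)\ge 2\,CAN(2,n,2)+2$.
   Context: A binary $t$-covering array of size $m$ and degree $n$ is an $m\times n$ matrix with entries in $\{0,1\}$ such that for any $t$ distinct columns, all $2^t$ binary vectors of length $t$ occur at least once as the restriction of some row to those columns. $CAN(t,n,2)$ denotes the minimum $m$ such that a binary $t$-covering array of size $m$ and degree $n$ exists. *)

(* Defs.v *)
From mathcomp Require Import all_boot all_algebra.

Set Implicit Arguments.
Unset Strict Implicit.
Unset Printing Implicit Defensive.

(* A choice of t distinct columns is an injective c : 'I_t -> 'I_n; the matrix
   colsub c (row i A) is the restriction of row i of A to these columns. *)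
Definition covering_array (t m n : nat) (A : 'M[bool]_(m, n)) : bool :=
  [forall c : {ffun 'I_t -> 'I_n}, injectiveb c ==>
    [forall v : 'rV[bool]_t, exists i : 'I_m, colsub c (row i A) == v]].

Definition has_covering_array (t n m : nat) : bool :=
  [exists A : 'M[bool]_(m, n), covering_array t A].

(* The array whose rows are all binary vectors of length n. *)
Lemma has_covering_array_ex (t n : nat) : exists m, has_covering_array t n m.
Proof.
exists #|{: 'rV[bool]_n}|; apply/existsP.
exists (\matrix_(i, j) (enum_val i : 'rV[bool]_n) ord0 j)%R.
apply/forallP => c; apply/implyP => /injectiveP c_inj.
apply/forallP => v; apply/existsP.
pose w : 'rV[bool]_n :=
  (\row_j (if [pick k | c k == j] is Some k then v ord0 k else false))%R.
exists (enum_rank w); apply/eqP/rowP => k; rewrite !mxE enum_rankK mxE.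
case: pickP => [l /eqP/c_inj -> // | /(_ k)]; by rewrite eqxx.
Qed.

(* CAN2 t n is CAN(t, n, 2). *)
Definition CAN2 (t n : nat) : nat := ex_minn (has_covering_array_ex t n).

(* Main.v *)
(* Write m = 2k.  In a 3-covering array with N <= 2m + 1 rows every column c has a
   symbol occurring on a set S_c of at most m rows, and the other n columns,
   restricted to S_c, form a 2-covering array.

   Such an array with n > C(2k-1, k-1) - k columns has exactly m rows and only
   balanced columns.  Indeed, picking from each column the smaller of its support
   and the complement gives an intersecting antichain of n sets of size at most k.
   Their supersets of size k form an intersecting family, hence there are at most
   C(2k, k) / 2 = C(2k-1, k-1) of them.  On the other hand pushing the antichain up
   level by level never loses sets, and the last step, from k-1 to k, gains at
   least k of them if it is not void: for u sets of size k-1 this is the local LYM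
   inequality when u >= k^2, and Cauchy-Schwarz for the degrees of the incidence
   graph, which has no 4-cycle, when u < k^2.

   Hence |S_c| = 2k and |S_c :&: S_j| = k for all c != j, so Fisher's inequality
   gives n + 1 <= N <= 4k + 1, which contradicts n > C(2k-1, k-1) - k. *)
Require Import Defs.
From mathcomp Require Import all_boot all_algebra zify.

Set Implicit Arguments.
Unset Strict Implicit.
Unset Printing Implicit Defensive.

(** * Local LYM bounds between consecutive levels *)

Definition supersets (T : finType) (r : nat) (F : {set {set T}}) : {set {set T}} :=
  [set D : {set T} | (#|D| == r) && [exists A in F, A \subset D]].

Lemma supersetsP (T : finType) (r : nat) (F : {set {set T}}) (D : {set T}) :
  reflect (#|D| = r /\ exists2 A, A \in F & A \subset D) (D \in supersets r F).
Proof.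
rewrite inE; apply: (iffP andP) => [[/eqP -> /exists_inP]|[-> AD]] //.
by split=> //; apply/exists_inP.
Qed.

Lemma card_covers (T : finType) (A : {set T}) :
  #|[set D : {set T} | A \subset D & #|D| == #|A|.+1]| = #|T| - #|A|.
Proof.
have -> : [set D : {set T} | A \subset D & #|D| == #|A|.+1]
          = [set x |: A | x in ~: A].
  apply/setP => D; rewrite inE; apply/andP/imsetP => [[AD /eqP cD]|[x]].
    have /cards1P [x Dx] : #|D :\: A| == 1 by rewrite cardsDS // cD subSnn.
    have /setDP [xD xA] : x \in D :\: A by rewrite Dx set11.
    exists x; first by rewrite inE.
    rewrite -Dx setUC; apply/setP => y; rewrite !inE.
    by case: (boolP (y \in A)) => // /(subsetP AD).
  by rewrite inE => xA ->; rewrite subsetUr cardsU1 xA.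
rewrite card_in_imset; first by rewrite cardsCs setCK.
move=> x y; rewrite !inE => xA yA /setP/(_ x).
by rewrite !inE eqxx (negPf xA) /= orbF => /esym/eqP.
Qed.

Lemma card_setE (I : finType) (P : {set I}) (Q : pred I) :
  #|[set i in P | Q i]| = \sum_(i in P) (Q i : nat).
Proof. by rewrite -sum1dep_card big_mkcondr. Qed.

Lemma sum_card_incidence (T : finType) (r : nat) (G : {set {set T}}) :
  (forall A, A \in G -> #|A| = r) ->
  \sum_(D in supersets r.+1 G) #|[set A in G | A \subset D]| = #|G| * (#|T| - r).
Proof.
move=> Gr.
under eq_bigr do rewrite card_setE.
rewrite exchange_big /= -sum_nat_const; apply: eq_bigr => A AG.
rewrite -card_setE -(Gr A AG) -card_covers; apply: eq_card => D.
rewrite !inE (Gr A AG) andbC; case AD: (A \subset D) => //=.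
by rewrite andb_idr // => _; apply/exists_inP; exists A.
Qed.

(** Double counting of inclusions: each [A] in [G] has [#|T| - r] supersets of size [r.+1], and each
    such [D] contains only [r.+1] sets of size [r]. *)
Lemma local_lym (T : finType) (r : nat) (G : {set {set T}}) :
  (forall A, A \in G -> #|A| = r) ->
  #|G| * (#|T| - r) <= #|supersets r.+1 G| * r.+1.
Proof.
move=> Gr; rewrite -sum_card_incidence // -sum_nat_const; apply: leq_sum => D /supersetsP [cD _].
have <- : #|[set A : {set T} | A \subset D & #|A| == r]| = r.+1.
  by rewrite cards_draws cD binSn.
by apply/subset_leq_card/subsetP => A; rewrite !inE => /andP [/Gr -> ->] /=.
Qed.

Lemma leq_sum_sqr (I : finType) (P : {set I}) (f : I -> nat) :
  (\sum_(i in P) f i) ^ 2 <= #|P| * \sum_(i in P) f i ^ 2.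
Proof.
rewrite -(leq_pmul2l (isT : 0 < 2)) expnS expn1 big_distrlr /=.
have -> : 2 * (#|P| * \sum_(i in P) f i ^ 2)
          = \sum_(i in P) \sum_(j in P) (f i ^ 2 + f j ^ 2).
  under [RHS]eq_bigr do rewrite big_split /= sum_nat_const.
  by rewrite big_split /= -big_distrr /= sum_nat_const mul2n addnn.
rewrite big_distrr; apply: leq_sum => i _; rewrite big_distrr; apply: leq_sum => j _.
exact: nat_Cauchy.
Qed.

(* Distinct sets of size [r] have at most one common superset of size [r.+1],
   which bounds the sum of the squared degrees of the incidence graph. *)
Lemma local_lym_sqr (T : finType) (r : nat) (G : {set {set T}}) :
  (forall A, A \in G -> #|A| = r) ->
  #|G| * (#|T| - r) ^ 2 <= #|supersets r.+1 G| * (#|T| - r + #|G|.-1).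
Proof.
move=> Gr; have [->|[A0 A0G]] := set_0Vmem G; first by rewrite cards0.
have G0 : 0 < #|G| by apply/card_gt0P; exists A0.
(* Multiplying by [#|G|] turns the left side into the square of the incidence count, ready for
   Cauchy-Schwarz. *)
rewrite -(leq_pmul2l G0).
have -> : #|G| * (#|G| * (#|T| - r) ^ 2) = (#|G| * (#|T| - r)) ^ 2 by rewrite expnMn mulnA.
rewrite -sum_card_incidence // mulnCA; apply: leq_trans (leq_sum_sqr _ _) _.
rewrite leq_mul2l; apply/orP; right.
under eq_bigr do rewrite expnS expn1 card_setE big_distrlr /=.
rewrite exchange_big /= -sum_nat_const; apply: leq_sum => A AG.
(* The diagonal term counts supersets of [A] alone; any other [B] contributes at most one set,
   namely [A :|: B]. *)
rewrite exchange_big /= (bigD1 A) //=; apply: leq_add.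
  under eq_bigr do rewrite mulnb andbb.
  rewrite -card_setE -(Gr A AG) -card_covers.
  apply/subset_leq_card/subsetP => D; rewrite !inE (Gr A AG).
  by move=> /andP [/andP [-> _] ->].
rewrite -[leqRHS]muln1 (cardsD1 A) AG add1n /= -sum_nat_const.
rewrite [leqRHS](eq_bigl (fun B => (B \in G) && (B != A))); last first.
  by move=> B; rewrite !inE andbC.
apply: leq_sum => B /andP [BG BA].
under eq_bigr do rewrite mulnb.
rewrite -card_setE; apply: (@leq_trans #|[set A :|: B]|); last by rewrite cards1.
apply/subset_leq_card/subsetP => D; rewrite inE => /and3P [/supersetsP [cD _] AD BD].
rewrite inE eq_sym eqEcard subUset AD BD cD /= -(Gr A AG); apply: proper_card.
rewrite properE subsetUl subUset subxx /=; apply: contra BA => BA.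
by rewrite eqEcard BA (Gr A AG) (Gr B BG) leqnn.
Qed.

(** * Pushing an antichain up to the middle level *)

Definition antichain (T : finType) (F : {set {set T}}) :=
  {in F &, forall A B : {set T}, A \subset B -> A = B}.

(** A member of [F] of size [r.+1] cannot lie above a smaller member, so the two families counted on
    the left are disjoint. *)
Lemma card_supersetsS (T : finType) (r : nat) (F : {set {set T}}) :
  antichain F ->
  #|supersets r.+1 (supersets r F)| + #|[set A in F | #|A| == r.+1]|
    <= #|supersets r.+1 F|.
Proof.
move=> antiF; set U := supersets _ _; set V := [set _ in _ | _].
have -> : #|U| + #|V| = #|U :|: V|.
  apply/esym/eqP; rewrite (leq_card_setU U V) disjoint_subset.
  apply/subsetP => D /supersetsP [cD [E /supersetsP [cE [A AF AE]] ED]].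
  rewrite !inE; apply/negP => /andP [DF _].
  have AD := antiF A D AF DF (subset_trans AE ED).
  by have := subset_leq_card AE; rewrite AD cD cE ltnn.
apply/subset_leq_card/subsetP => D; rewrite inE => /orP [].
  move=> /supersetsP [cD [E /supersetsP [_ [A AF AE]] ED]].
  by apply/supersetsP; split=> //; exists A => //; apply: subset_trans ED.
by rewrite inE => /andP [DF /eqP cD]; apply/supersetsP; split=> //; exists D.
Qed.

Lemma supersets_card (T : finType) (r : nat) (F : {set {set T}}) (D : {set T}) :
  D \in supersets r F -> #|D| = r.
Proof. by case/supersetsP. Qed.

Lemma card_bounded_split (T : finType) (r : nat) (F : {set {set T}}) :
  #|[set A in F | #|A| <= r.+1]|
    = #|[set A in F | #|A| <= r]| + #|[set A in F | #|A| == r.+1]|.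
Proof.
rewrite !card_setE -big_split /=; apply: eq_bigr => A _.
by rewrite leq_eqVlt ltnS addnC; case: eqP => [->|] /=; rewrite ?ltnn.
Qed.

(** In the step to [r.+1] the size condition gives [r.+1 <= #|T| - r], so by local LYM the next
    level is at least as large. *)
Lemma leq_card_supersets (T : finType) (r : nat) (F : {set {set T}}) :
  antichain F -> r.*2 <= #|T|.+1 ->
  #|[set A in F | #|A| <= r]| <= #|supersets r F|.
Proof.
move=> antiF; elim: r => [|r IHr] hr.
  apply/subset_leq_card/subsetP => A; rewrite inE leqn0 => /andP [AF /eqP cA].
  by apply/supersetsP; split=> //; exists A.
rewrite card_bounded_split; apply: leq_trans (card_supersetsS r antiF).
rewrite leq_add2r; apply: leq_trans (IHr _) _; first by lia.
have /local_lym := @supersets_card T r F.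
move: #|supersets r F| #|supersets r.+1 _| => u v; nia.
Qed.

Lemma card_supersets_gain (T : finType) (k : nat) (F : {set {set T}}) :
  #|T| = k.*2 -> antichain F -> (forall A, A \in F -> #|A| <= k) ->
  (exists2 A, A \in F & #|A| < k) -> #|F| + k <= #|supersets k F|.
Proof.
case: k => [|k] cT antiF Fk [A0 A0F A0k] //.
apply: leq_trans (card_supersetsS k antiF).
(* From here [k] is one less than in the statement. The members of size [k.+1] occur on both sides
   and will cancel. *)
have -> : F = [set A in F | #|A| <= k.+1].
  by apply/setP => A; rewrite inE; case: (boolP (A \in F)) => //= /Fk ->.
rewrite card_bounded_split.
have <- : F = [set A in F | #|A| <= k.+1].
  by apply/setP => A; rewrite inE; case: (boolP (A \in F)) => //= /Fk ->.
rewrite addnAC leq_add2r.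
have Fu : #|[set A in F | #|A| <= k]| <= #|supersets k F|.
  by apply: leq_card_supersets => //; lia.
have u0 : 0 < #|[set A in F | #|A| <= k]|.
  by apply/card_gt0P; exists A0; rewrite inE A0F.
have := local_lym (@supersets_card T k F).
have := local_lym_sqr (@supersets_card T k F).
rewrite cT (_ : k.+1.*2 - k = k.+2); last by lia.
move: Fu u0; move: #|[set _ in _ | _]| #|supersets k F| #|supersets k.+1 _| => f u v.
move=> fu f0 sqr lin; suff : u + k.+1 <= v by lia.
rewrite leqNgt; apply/negP => vlt.
(* Put K = k + 1. Local LYM reads u (K + 1) <= v K, which for u >= K^2 forces v >= u + K. For
   smaller u, the bound v <= u + K - 1 contradicts [sqr]. *)
have [uk|uk] := leqP (k.+1 ^ 2) u.
  have : v * k.+1 <= (u + k) * k.+1 by apply: leq_mul; lia.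
  move: lin uk; rewrite expnS expn1; clear; nia.
have u1 : 0 < u by lia.
have h1 : v * (k.+2 + u.-1) <= (u + k) * (u + k.+1).
  by apply: leq_mul; lia.
(* With K = k.+1, u (K + 1)^2 - (u + K)^2 = (u - 1) (K^2 - u). *)
have h2 : 0 < u * k.+2 ^ 2 - (u + k) * (u + k.+1).
  case: u u1 {fu sqr lin vlt h1} uk => // u _; rewrite !expnS !expn0 !muln1 => uk.
  have := leq_mul (leqnn u) uk; nia.
lia.
Qed.

(** Any two of the supersets meet, so none is the complement of another: the supersets and their
    complements are disjoint families of [k]-sets. *)
Lemma card_supersets_intersecting (T : finType) (k : nat) (F : {set {set T}}) :
  #|T| = k.*2 -> {in F &, forall A B : {set T}, A :&: B != set0} ->
  #|supersets k F|.*2 <= 'C(k.*2, k).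
Proof.
move=> cT intF; pose W := [set ~: D | D in supersets k F].
have cW : #|W| = #|supersets k F| by apply/card_imset/setC_inj.
have -> : #|supersets k F|.*2 = #|supersets k F :|: W|.
  rewrite -addnn -{2}cW; apply/esym/eqP; rewrite (leq_card_setU _ W).
  rewrite disjoint_subset; apply/subsetP => D /supersetsP [_ [A AF AD]].
  rewrite inE; apply/imsetP => -[E /supersetsP [_ [B BF BE]] DE].
  move: (intF A B AF BF); rewrite setI_eq0 disjoint_subset => /negP []; apply/subsetP => x.
  by move=> /(subsetP AD); rewrite DE inE inE; apply: contra => /(subsetP BE).
rewrite -cT -cardsT -cards_draws; apply/subset_leq_card/subsetP => D.
rewrite !inE subsetT /= => /orP [/andP [] // | /imsetP [E /supersetsP [cE _] ->]].
by rewrite [#|_|]cardsCs setCK cE cT; apply/eqP; lia.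
Qed.

Lemma bin_central (k : nat) : 0 < k -> 'C(k.*2, k) = 'C(k.*2.-1, k.-1).*2.
Proof.
case: k => // k _; rewrite doubleS /= binS -[RHS]addnn; congr (_ + _).
by rewrite -bin_sub; [congr binomial; lia | lia].
Qed.

(** * Balance of pairwise qualitatively independent sets *)

Definition separated (T I : finType) (F : I -> {set T}) :=
  forall (i j : I) (a b : bool), i != j ->
  exists x, (x \in F i) = a /\ (x \in F j) = b.

(** One unbalanced set would make the family gain [k] sets at the middle level, and [n + k] exceeds
    half of ['C(k.*2, k)]. *)
Lemma separated_balanced (T : finType) (k n : nat) (F : 'I_n -> {set T}) :
  #|T| = k.*2 -> 1 < n -> 'C(k.*2.-1, k.-1) < n + k ->
  separated F -> forall i, #|F i| = k.
Proof.
move=> cT n1 nk sepF.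
have cC (A : {set T}) : #|A| + #|~: A| = k.*2 by rewrite cardsC.
pose s i := #|F i| <= k.
pose B i := if s i then F i else ~: F i.
have inB i x : (x \in B i) = ((x \in F i) == s i).
  by rewrite /B; case: (s i); rewrite ?inE; case: (x \in F i).
(* Complementing some of the sets only permutes the four patterns. *)
have sepB i j a b : i != j -> exists x, (x \in B i) = a /\ (x \in B j) = b.
  move=> ij; have [x [xi xj]] := sepF i j (a == s i) (b == s j) ij.
  by exists x; rewrite !inB xi xj; case: a b (s i) (s j) {xi xj} => [] [] [] [].
have BK i j : B i \subset B j -> i = j.
  move=> /subsetP Bij; apply/eqP/negP => /negP /(sepB i j true false) [x [xi xj]].
  by have := Bij x xi; rewrite xj.
have cB i : #|B i| <= k.
  by rewrite /B; case: ifP => // /negbT; rewrite -ltnNge; move: (cC (F i)); lia.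
have ltB i : #|F i| != k -> #|B i| < k.
  by rewrite /B /s; case: ifP; move: (cC (F i)); lia.
move=> i; apply/eqP/negP => /negP /ltB Bi.
pose G := [set B j | j in 'I_n].
have cG : #|G| = n.
  rewrite card_imset ?card_ord // => j l Bjl; apply: BK; by rewrite Bjl.
have gain : #|G| + k <= #|supersets k G|.
  apply: card_supersets_gain => //.
  - by move=> _ _ /imsetP [j _ ->] /imsetP [l _ ->] /BK ->.
  - by move=> _ /imsetP [j _ ->].
  - by exists (B i) => //; apply: imset_f.
have int : #|supersets k G|.*2 <= 'C(k.*2, k).
  apply: card_supersets_intersecting => // _ _ /imsetP [j _ ->] /imsetP [l _ ->].
  apply/set0Pn; have [->|jl] := eqVneq j l.
    (* A set meets itself only if it is nonempty; a pattern with a second index, available since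
       [1 < n], provides a point. *)
    have [l' ll'] : exists l', l != l'.
      pose o0 := Ordinal (ltnW n1); pose o1 := Ordinal n1.
      by have [->|] := eqVneq l o0; [exists o1 | exists o0].
    by have [x [xl _]] := sepB l l' true true ll'; exists x; rewrite inE xl.
  by have [x [xj xl]] := sepB j l true true jl; exists x; rewrite inE xj xl.
have := bin_central (leq_ltn_trans (leq0n _) Bi).
lia.
Qed.

(* The ground set is [S] padded by [k.*2 - #|S|] points lying in all the sets or in
   none of them; both paddings are balanced, so there is in fact no padding. *)
Lemma separated_on_balanced (T : finType) (k n : nat) (F : 'I_n -> {set T})
    (S : {set T}) :
  #|S| <= k.*2 -> 1 < n -> 'C(k.*2.-1, k.-1) < n + k ->
  (forall (i j : 'I_n) (a b : bool), i != j ->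
     exists2 x, x \in S & (x \in F i) = a /\ (x \in F j) = b) ->
  #|S| = k.*2 /\ forall i, #|S :&: F i| = k.
Proof.
move=> cS n1 nk sepF; set d := k.*2 - #|S|.
pose T' := ({x | x \in S} + 'I_d)%type.
pose F' (b : bool) (i : 'I_n) : {set T'} :=
  [set z | match z with inl x => val x \in F i | inr _ => b end].
have cT' : #|{: T'}| = k.*2 by rewrite card_sum card_sig card_ord subnKC.
have cF' b i : #|F' b i| = #|S :&: F i| + b * d.
  rewrite cardsE -sum1_card big_sumType /=; congr (_ + _).
    rewrite sum1_card -(card_imset _ val_inj); apply: eq_card => x.
    rewrite inE; apply/imsetP/andP => [[y yF ->]|[xS xF]].
      by split; [exact: (valP y) | exact: yF].
    by exists (Sub x xS).
  by case: b; rewrite ?mul1n ?mul0n ?big_pred0_eq // sum1_card card_ord.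
have balF' b i : #|F' b i| = k.
  apply: separated_balanced => // {}i j a c ij.
  have [x xS [xi xj]] := sepF i j a c ij.
  by exists (inl (Sub x xS)); rewrite !inE.
have o := Ordinal (ltnW n1); split; last by move=> i; rewrite -(balF' false i) cF' addn0.
by have := balF' true o; have := balF' false o; rewrite !cF' mul0n mul1n /d; lia.
Qed.

(** * Fisher's inequality *)

Section Fisher.

Import GRing.Theory Num.Theory.
Local Open Scope ring_scope.

(** The Gram matrix of the incidence matrix is (d - l) I + l J, nonsingular for l < d, so the
    incidence matrix has rank [p]. *)
Lemma fisher_inequality (p N d l : nat) (S : 'I_p -> {set 'I_N}) :
  (forall i, #|S i| = d) -> (forall i j, i != j -> #|S i :&: S j| = l) ->
  (l < d)%N -> (p <= N)%N.
Proof.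
move=> Sd Sl ld.
pose M : 'M[rat]_(p, N) := \matrix_(i, x) (x \in S i)%:R.
have MMT i j : (M *m M^T) i j = (d - l)%:R * (i == j)%:R + l%:R.
  rewrite mxE; under eq_bigr do rewrite !mxE -natrM mulnb -in_setI.
  rewrite -natr_sum -natrM -natrD; congr (_%:R).
  rewrite -big_mkcond /= sum1_card.
  have [->|ij] := eqVneq i j; first by rewrite setIid Sd muln1 subnK // ltnW.
  by rewrite Sl // muln0.
suff freeM : row_free M by rewrite -(eqP freeM) rank_leq_col.
apply/row_freeP; exists (M^T *m invmx (M *m M^T)).
rewrite mulmxA mulmxV // -row_free_unit -kermx_eq0; apply/rowV0P => v /sub_kermxP vM.
pose s := \sum_i v ord0 i.
have vE j : (d - l)%:R * v ord0 j + l%:R * s = 0.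
  have /rowP/(_ j) := vM; rewrite [RHS]mxE mxE => vMj; rewrite -[RHS]vMj.
  under [RHS]eq_bigr do rewrite MMT mulrDr.
  rewrite big_split /= -mulr_suml (mulrC _ l%:R); congr (_ + _).
  rewrite (bigD1 j) //= eqxx mulr1 mulrC big1 ?addr0 // => i /negPf ->.
  by rewrite !mulr0.
(* Summing [vE] over [j] gives s a positive coefficient, hence s = 0, and then [vE] makes each entry
   of [v] vanish. *)
have s0 : ((d - l)%:R + p%:R * l%:R) * s = 0.
  have : \sum_j ((d - l)%:R * v ord0 j + l%:R * s) = 0 by apply: big1.
  rewrite big_split /= -mulr_sumr sumr_const card_ord -[_ *+ p]mulr_natl.
  by rewrite mulrDl mulrA.
move/eqP: s0; rewrite mulf_eq0 -natrM -natrD pnatr_eq0 addn_eq0 subn_eq0 leqNgt ld /= => /eqP s0.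
apply/rowP => j; rewrite mxE; have /eqP := vE j.
by rewrite s0 mulr0 addr0 mulf_eq0 pnatr_eq0 subn_eq0 leqNgt ld => /eqP.
Qed.

End Fisher.

(** * Covering arrays and the final count *)

Lemma covering_array_row (t m n : nat) (A : 'M[bool]_(m, n)) :
  covering_array t A -> forall (c : t.-tuple 'I_n) (v : t.-tuple bool), uniq c ->
  exists r, [seq A r j | j <- c] = v.
Proof.
move=> /forallP covA c v /tuple_uniqP c_inj.
have := covA [ffun i => tnth c i]; rewrite (_ : injectiveb _ = true) /=; last first.
  by apply/injectiveP => i j; rewrite !ffunE => /c_inj.
move=> /forallP/(_ (\row_i tnth v i)%R) /existsP [r /eqP /rowP Ar]; exists r.
suff <- : map_tuple (A r) c = v by [].
by apply: eq_from_tnth => i; have := Ar i; rewrite tnth_map !mxE ffunE.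
Qed.

Lemma covering_array2_separated (m n : nat) (F : 'I_n -> {set 'I_m}) :
  separated F -> covering_array 2 (\matrix_(r, j) (r \in F j))%R.
Proof.
move=> sepF; apply/forallP => c; apply/implyP => /injectiveP c_inj; apply/forallP => v.
have c01 : c ord0 != c ord_max by rewrite (inj_eq c_inj).
have [r [r0 r1]] := sepF _ _ (v ord0 ord0) (v ord0 ord_max) c01.
apply/existsP; exists r; apply/eqP/rowP => i; rewrite !mxE.
have [->|i0] := eqVneq i ord0; first by rewrite r0.
suff -> : i = ord_max by rewrite r1.
by apply: val_inj; case: i i0 => -[|[|]].
Qed.

Lemma CAN2_min (t n m : nat) : has_covering_array t n m -> CAN2 t n <= m.
Proof. by rewrite /CAN2; case: ex_minnP => c _; apply. Qed.

(** The columns are [k]-sets through a common point [x0], which realises the pattern 11. Distinct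
    sets of equal size give 10 and 01, and a union of at most 2k - 1 points leaves a row for 00. *)
Lemma CAN2_2_leq (k n : nat) :
  0 < k -> n <= 'C(k.*2.-1, k.-1) -> CAN2 2 n <= k.*2.
Proof.
move=> k0 nk; apply: CAN2_min.
have k20 : 0 < k.*2 by lia.
pose x0 := Ordinal k20.
pose G := [set B : {set 'I_k.*2} | B \subset [set~ x0] & #|B| == k.-1].
have cG : n <= #|G| by rewrite cards_draws cardsC1 card_ord.
pose B (i : 'I_n) := enum_val (widen_ord cG i).
have BG i : B i \in G := enum_valP _.
have cB i : #|B i| = k.-1 by have := BG i; rewrite inE => /andP [_ /eqP].
have x0B i : x0 \notin B i.
  have := BG i; rewrite inE => /andP [/subsetP BC _].
  by apply/negP => /BC; rewrite !inE eqxx.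
have BD i j : i != j -> exists2 x, x \in B i & x \notin B j.
  move=> ij; suff /subsetPn [x xi xj] : ~~ (B i \subset B j) by exists x.
  apply: contra ij => Bij; have : B i == B j by rewrite eqEcard Bij !cB leqnn.
  by rewrite /B (inj_eq enum_val_inj).
apply/existsP; exists (\matrix_(r, j) (r \in x0 |: B j))%R.
apply: covering_array2_separated => i j a b ij.
case: a b => [] [].
- by exists x0; rewrite !setU11.
- have [x xi xj] := BD i j ij; exists x; rewrite !inE xi (negPf xj) orbT orbF.
  by split=> //; apply: contraNF (x0B i) => /eqP <-.
- rewrite eq_sym in ij.
  have [x xj xi] := BD j i ij; exists x; rewrite !inE xj (negPf xi) orbT orbF.
  by split=> //; apply: contraNF (x0B j) => /eqP <-.
- have : 0 < #|~: (x0 |: (B i :|: B j))|.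
    rewrite cardsCs setCK card_ord cardsU1 subn_gt0.
    have := (leq_card_setU (B i) (B j)).1; rewrite !cB; move: #|_|; case: (_ \notin _) => u /=; lia.
  move=> /card_gt0P [x]; rewrite !inE !negb_or => /and3P [x1 x2 x3]; exists x.
  by rewrite !inE (negPf x1) (negPf x2) (negPf x3).
Qed.

(** The factor 5 yields n > 5k - k = 4k in the theorem. The induction starts at 'C(7, 3) = 35, and
    the binomial at least doubles at each step. *)
Lemma leq_bin_central (k : nat) : 4 <= k -> 5 * k <= 'C(k.*2.-1, k.-1).
Proof.
elim: k => // k IHk; rewrite leq_eqVlt => /orP [/eqP <- //|k4].
have := IHk k4; have k0 : 0 < k by lia.
have := bin_central k0; case: k {IHk k4 k0} => // k; rewrite !doubleS /=.
by rewrite [in X in _ -> _ -> _ <= X]binS; lia.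
Qed.

Theorem theorem4p8 (m n : nat) :
  8 <= m -> ~~ odd m ->
  'C(m.-1, (m./2).-1) - m./2 < n <= 'C(m.-1, (m./2).-1) ->
  2 * CAN2 2 n + 2 <= CAN2 3 n.+1.
Proof.
move=> m8 m_even; have [k mk] : exists k, m = k.*2 by exists m./2; lia.
rewrite {}mk doubleK in m8 m_even * => /andP [n_gt n_le].
have k4 : 4 <= k by lia.
have CAN_le : CAN2 2 n <= k.*2 by apply: CAN2_2_leq => //; lia.
have C5 := leq_bin_central k4.
rewrite [leqRHS]/CAN2; case: ex_minnP => N /existsP [A covA] _.
rewrite leqNgt; apply/negP => N_lt.
(* [s c] is a symbol occurring at most [k.*2] times in column [c]. *)
pose s c := #|[set r | A r c]| <= k.*2.
pose S c := [set r | A r c == s c].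
have cS c : #|S c| <= k.*2.
  have cA : #|[set r | A r c]| + #|~: [set r | A r c]| = N by rewrite cardsC card_ord.
  have [sc|sc] := boolP (s c).
    have -> : S c = [set r | A r c] by apply/setP => r; rewrite !inE sc eqb_id.
    exact: sc.
  have -> : S c = ~: [set r | A r c].
    by apply/setP => r; rewrite !inE (negPf sc) eqbF_neg.
  (* Here N <= 4k + 1, so a symbol occurring more than 2k times leaves at most 2k rows to the
     other. *)
  by move: sc; rewrite /s -ltnNge; lia.
have bal c : #|S c| = k.*2 /\ forall i, #|S c :&: S (lift c i)| = k.
  apply: separated_on_balanced => //; [lia | lia | move=> i j a b ij].
  have c_uniq : uniq [tuple c; lift c i; lift c j].
    by rewrite /= !inE !(inj_eq lift_inj) ij !(negPf (neq_lift _ _)).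
  (* Prescribing the symbol [a == s _] makes membership in [S _] equal to [a], whichever symbol
     [s _] is. *)
  have [r [rc ri rj]] := covering_array_row covA
    [tuple s c; a == s (lift c i); b == s (lift c j)] c_uniq.
  exists r; rewrite !inE ?rc // ri rj.
  by case: a b (s _) (s _) {ri rj c_uniq} => [] [] [] [].
suff : n.+1 <= N by lia.
apply: (@fisher_inequality _ _ k.*2 k S); [by move=> c; case: (bal c) | | lia].
move=> c j cj; have [_ balc] := bal c.
by case: (unliftP c j) cj => [i ->|->]; rewrite ?eqxx.
Qed.
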